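(* Fix integers $n\ge 1$ and $q\geq 1$. Suppose $\ell\ge n$ is the smallest integer such that $\tilde{H}_q(\mathcal{VR}(\mathcal{F}_n^{[\ell]};2(n-1)))$ is nontrivial. Then $$\operatorname{rank}\tilde{H}_q\big(\mathcal{VR}(\mathcal{F}_n^{[\ell+1]};2(n-1))\big)\geq \ell\cdot\operatorname{rank}\tilde{H}_q\big(\mathcal{VR}(\mathcal{F}_n^{[\ell]};2(n-1))\big).$$
   Context: $\mathcal{F}_n^{[m]}$ is the set of $n$-element subsets of $[m]=\{1,\dots,m\}$ with metric $d(A,B)=|A\triangle B|$. $\mathcal{VR}(X;r)$ is the simplicial complex on $X$ whose simplices are nonempty finite sets of pairwise distance $\le r$. Note $\mathcal{VR}(\mathcal{F}_n^{[2n+k]};2(n-1))$ is the independence complex of the Kneser graph $\mathrm{KG}(n,k)$. $\tilde H_q$ denotes reduced simplicial homology with real coefficients, and rank means dimension. *)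

(* Defs.v *)
From HB Require Import structures.
From mathcomp Require Import all_boot all_order all_algebra.

Set Implicit Arguments.
Unset Strict Implicit.
Unset Printing Implicit Defensive.

Import GRing.Theory.
Local Open Scope ring_scope.

Record simplicial_complex (X : finType) := SimplicialComplex {
  simplices :> {set {set X}};
  simplices_nonempty : set0 \notin simplices;
  simplices_closed : forall s t : {set X},
    s \in simplices -> t \subset s -> t != set0 -> t \in simplices
}.

Definition VR_simplices (X : finType) (d : X -> X -> nat) (r : nat) :
    {set {set X}} :=
  [set s : {set X} | (s != set0) &&
     [forall x in s, forall y in s, (d x y <= r)%N]].

Lemma VR_nonempty (X : finType) (d : X -> X -> nat) (r : nat) :
  set0 \notin VR_simplices d r.
Proof. by rewrite inE eqxx. Qed.

Lemma VR_closed (X : finType) (d : X -> X -> nat) (r : nat) (s t : {set X}) :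
  s \in VR_simplices d r -> t \subset s -> t != set0 ->
  t \in VR_simplices d r.
Proof.
rewrite !inE => /andP[_ /forall_inP h] /subsetP ts t0; rewrite t0 /=.
apply/forall_inP => x /ts xs; apply/forall_inP => y /ts ys.
exact: (forall_inP (h x xs)).
Qed.

Definition VR (X : finType) (d : X -> X -> nat) (r : nat) :
    simplicial_complex X :=
  SimplicialComplex (@VR_nonempty X d r) (@VR_closed X d r).

Section Chains.
Variables (R : fieldType) (X : finType).

(* Formal R-linear combinations of subsets of X.  A set s stands for the
   oriented simplex obtained by listing its elements increasingly for
   [enum_rank]; set0 is the generator of degree -1 of the augmented complex. *)
Definition chain := {ffun {set X} -> R^o}.

Definition elementary_chain (s : {set X}) : chain :=
  [ffun t => (t == s)%:R : R^o].

Definition position (s : {set X}) (v : X) : nat :=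
  #|[set u in s | (enum_rank u < enum_rank v)%N]|.

Definition simplex_boundary (s : {set X}) : chain :=
  \sum_(v in s) (-1) ^+ position s v *: elementary_chain (s :\ v).

Definition boundary_fun (c : chain) : chain :=
  \sum_(s : {set X}) (c s : R) *: simplex_boundary s.

Fact boundary_fun_is_linear : linear boundary_fun.
Proof.
move=> a c c'; rewrite /boundary_fun scaler_sumr -big_split /=.
by apply: eq_bigr => s _; rewrite !ffunE scalerDl scalerA.
Qed.

HB.instance Definition _ :=
  GRing.isLinear.Build R chain chain _ boundary_fun boundary_fun_is_linear.

Definition boundary : 'End(chain) := linfun boundary_fun.

(* The index k is the number of vertices: [chains K k] is the group of
   augmented simplicial chains of dimension k - 1, and [chains K 0] is the
   line spanned by set0. *)
Definition chains (K : simplicial_complex X) (k : nat) : {vspace chain} :=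
  <<[seq elementary_chain s |
       s <- enum [set s in set0 |: simplices K | #|s| == k]]>>%VS.

Definition cycles (K : simplicial_complex X) (q : nat) : {vspace chain} :=
  (chains K q.+1 :&: lker boundary)%VS.

Definition boundaries (K : simplicial_complex X) (q : nat) : {vspace chain} :=
  (boundary @: chains K q.+2)%VS.

(* The quotient of cycles by boundaries, realized as the complement of the
   boundaries chosen by [diffv]; see [homology_classP] for the quotient map. *)
Definition reduced_homology (K : simplicial_complex X) (q : nat) :
    {vspace chain} :=
  (cycles K q :\: boundaries K q)%VS.

Definition homology_class (K : simplicial_complex X) (q : nat) : 'End(chain) :=
  addv_pi1 (cycles K q) (boundaries K q).

Lemma boundary_elementary (s : {set X}) :
  boundary (elementary_chain s) = simplex_boundary s.
Proof.
rewrite lfunE /= /boundary_fun (bigD1 s) //= big1 ?addr0.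
  by rewrite ffunE eqxx scale1r.
by move=> t ts; rewrite ffunE (negPf ts) scale0r.
Qed.

Lemma boundary_sqr (c : chain) : boundary (boundary c) = 0.
Proof.
have -> : boundary c = \sum_(s : {set X}) (c s : R) *: simplex_boundary s.
  by rewrite lfunE.
rewrite linear_sum /= big1 // => s _; rewrite linearZ /=.
suff -> : boundary (simplex_boundary s) = 0 by rewrite scaler0.
pose lt (u v : X) := (enum_rank u < enum_rank v)%N.
pose F u v : chain :=
  ((-1) ^+ position s v * (-1) ^+ position (s :\ v) u : R) *:
    elementary_chain (s :\ v :\ u).
have Fanti u v : u \in s -> lt u v -> F u v = - F v u.
  rewrite /lt => us uv; have nvu : (enum_rank v < enum_rank u)%N = false.
    by apply/negbTE; rewrite -leqNgt ltnW.
  have pu : position (s :\ v) u = position s u.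
    apply: eq_card => w; rewrite !inE.
    by case: (w =P v) => [->|_]; rewrite ?nvu ?andbF /=.
  have pv : position s v = (position (s :\ u) v).+1.
    rewrite /position (cardsD1 u) !inE us uv /= add1n; congr _.+1.
    by apply: eq_card => w; rewrite !inE andbA.
  have -> : F u v = ((-1) ^+ position s v * (-1) ^+ position s u : R) *:
      elementary_chain (s :\ v :\ u) by rewrite /F pu.
  rewrite pv exprS mulN1r mulNr scaleNr /F mulrC; congr (- (_ *: _)).
  by congr elementary_chain; rewrite !setDDl setUC.
have -> : boundary (simplex_boundary s) =
    \sum_(v in s) \sum_(u in s) (if u == v then 0 else F u v).
  rewrite linear_sum; apply: eq_bigr => v vs.
  rewrite linearZ /= boundary_elementary scaler_sumr.
  rewrite big_mkcond [RHS]big_mkcond; apply: eq_bigr => u _ /=.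
  by rewrite !inE; case: eqP => //= _; case: ifP => //; rewrite scalerA.
have split u v : (if u == v then 0 else F u v) =
    (if lt u v then F u v else 0) + (if lt v u then F u v else 0).
  rewrite /lt -(inj_eq (@enum_rank_inj X)) -val_eqE /=.
  by case: ltngtP; rewrite ?addr0 ?add0r.
under eq_bigr do under eq_bigr do rewrite split.
under eq_bigr do rewrite big_split.
rewrite big_split /= [X in _ + X]exchange_big /= -big_split /=.
apply: big1 => v vs; rewrite -big_split /=; apply: big1 => u us.
by case: ifP => [uv|_]; rewrite ?addr0 // (Fanti u v us uv) addNr.
Qed.

Lemma boundaries_sub_cycles (K : simplicial_complex X) (q : nat) :
  (boundaries K q <= cycles K q)%VS.
Proof.
rewrite subv_cap; apply/andP; split; last first.
  by apply/subvP => x /memv_imgP[c _ ->]; rewrite memv_ker boundary_sqr.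
rewrite /boundaries /chains limg_span; apply/span_subvP => c /mapP[e /mapP[s]].
rewrite mem_enum !inE => /andP[sK /eqP cs] -> ->.
rewrite boundary_elementary; apply: memv_suml => v vs; apply: memvZ.
apply: memv_span; apply: map_f; rewrite mem_enum !inE.
have cv : #|s :\ v| = q.+1.
  by move: (cardsD1 v s); rewrite vs cs add1n => -[<-].
rewrite cv eqxx andbT; apply/orP; right.
have v0 : s :\ v != set0 by rewrite -card_gt0 cv.
apply: simplices_closed v0; last exact: subsetDl.
by case/predU1P: sK => // s0; rewrite s0 cards0 in cs.
Qed.

Lemma homology_classP (K : simplicial_complex X) (q : nat) :
  (homology_class K q @: cycles K q = reduced_homology K q)%VS /\
  (cycles K q :&: lker (homology_class K q) = boundaries K q)%VS.
Proof.
have BZ := boundaries_sub_cycles K q; set Z := cycles K q in BZ *.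
set B := boundaries K q in BZ *; split; apply/vspaceP => c.
  apply/memv_imgP/idP => [[z zZ ->]|cH]; first exact: memv_pi.
  exists c; first exact: subvP (diffvSl Z B) _ cH.
  by rewrite /homology_class /addv_pi1 daddv_pi_id // capv_diff.
rewrite memv_cap memv_ker; apply/andP/idP => [[cZ /eqP c0]|cB].
  have := addv_pi1_pi2 (subvP (addvSl Z B) _ cZ).
  by rewrite [addv_pi1 Z B c]c0 add0r => <-; apply: memv_pi2.
have cZ := subvP BZ _ cB; split=> //.
have := addv_pi1_pi2 (subvP (addvSl Z B) _ cZ).
by rewrite (addv_pi2_id _ cB) => /(canRL (addrK c)) ->; rewrite subrr.
Qed.

Definition rank_reduced_homology (K : simplicial_complex X) (q : nat) : nat :=
  \dim (reduced_homology K q).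

End Chains.

(* The paper's [m] = {1, ..., m} is rendered as 'I_m = {0, ..., m - 1}. *)
Definition Fsets (n m : nat) : finType := {A : {set 'I_m} | #|A| == n}.

Definition Fdist (n m : nat) (A B : Fsets n m) : nat :=
  #|(val A :\: val B) :|: (val B :\: val A)|.

Definition VRF (n m r : nat) : simplicial_complex (Fsets n m) :=
  VR (@Fdist n m) r.

(* Main.v *)
(* Write X_m for the complex on the n-subsets of an m-set; its simplices are the
   pairwise intersecting families.  For each point i of an (l+1)-set, X_(l+1)
   contains a copy K_i of X_l, spanned by the n-sets avoiding i.  Fix a point k.
   Trading i for k (or for any missing point, if k is already present) is a
   simplicial retraction r_i of X_(l+1) onto K_i: two n-sets that meet only in i
   are sent to sets that meet in k.  For the same reason the choice of the
   missing point affects r_i only up to contiguity.  For j different from i and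
   k that point can be chosen different from j, and then r_i maps K_j into the
   intersection of K_i and K_j, a copy of X_(l-1), whose q-th homology vanishes
   by minimality of l.  So the l copies of the homology of X_l carried by the
   K_i, for i other than k, are independent: r_i is the identity on the i-th one
   and kills the others.

   Signs are handled by viewing the augmented chains as an exterior algebra: the
   boundary is an antiderivation, and a map of vertices induces an algebra
   morphism. *)
From HB Require Import structures.
Require Import Defs.
From mathcomp Require Import all_boot all_order all_algebra.
From mathcomp Require Import reals.

Set Implicit Arguments.
Unset Strict Implicit.
Unset Printing Implicit Defensive.

Import GRing.Theory.
Local Open Scope ring_scope.

(** * Augmented chains as an exterior algebra *)

Section ExteriorAlgebra.
Variables (R : fieldType) (X : finType).
Implicit Types (s t : {set X}) (u v : X) (l : seq X) (c : chain R X).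

Lemma chain_sum c :
  c = \sum_(s : {set X}) (c s : R) *: elementary_chain R s.
Proof.
apply/ffunP => t; rewrite sum_ffunE (bigD1 t) //= big1 ?addr0.
  by rewrite !ffunE eqxx [_ *: _]mulr1.
by move=> s st; rewrite !ffunE eq_sym (negPf st) scaler0.
Qed.

Section Extension.
Variables (V : vectType R) (F : {set X} -> V).

Definition extend_fun c : V := \sum_(s : {set X}) (c s : R) *: F s.

Fact extend_fun_is_linear : linear extend_fun.
Proof.
move=> a c c'; rewrite /extend_fun scaler_sumr -big_split /=.
by apply: eq_bigr => s _; rewrite !ffunE scalerDl scalerA.
Qed.

HB.instance Definition _ :=
  GRing.isLinear.Build R (chain R X) V _ extend_fun extend_fun_is_linear.

Definition extend : 'Hom(chain R X, V) := linfun extend_fun.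

Lemma extendE s : extend (elementary_chain R s) = F s.
Proof.
rewrite lfunE /= /extend_fun (bigD1 s) //= big1 ?addr0.
  by rewrite ffunE eqxx scale1r.
by move=> t ts; rewrite ffunE (negPf ts) scale0r.
Qed.

End Extension.

Lemma eq_on_elementary (V : vectType R) (f g : 'Hom(chain R X, V)) :
  (forall s, f (elementary_chain R s) = g (elementary_chain R s)) -> f =1 g.
Proof.
move=> fg c; rewrite [c]chain_sum !linear_sum; apply: eq_bigr => s _.
by rewrite !linearZ /= fg.
Qed.

Definition spanned (S : {set {set X}}) : {vspace chain R X} :=
  <<[seq elementary_chain R s | s <- enum S]>>%VS.

Lemma mem_spanned (S : {set {set X}}) s :
  s \in S -> elementary_chain R s \in spanned S.
Proof. by move=> sS; apply/memv_span/map_f; rewrite mem_enum. Qed.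

Lemma spanned_image (V : vectType R) (f : 'Hom(chain R X, V))
    (S : {set {set X}}) (U : {vspace V}) c :
  (forall s, s \in S -> f (elementary_chain R s) \in U) ->
  c \in spanned S -> f c \in U.
Proof.
move=> fU /(memv_img f); apply: subvP; rewrite limg_span.
apply/span_subvP => _ /mapP[_ /mapP[s sS ->] ->]; apply: fU.
by rewrite mem_enum in sS.
Qed.

Lemma position_setU1 s u v : v \notin s ->
  position (v |: s) u = ((enum_rank v < enum_rank u) + position s u)%N.
Proof.
move=> vs; rewrite /position (cardsD1 v) !inE eqxx /=; congr (_ + _)%N.
apply: eq_card => w; rewrite !inE.
by case: eqP => //= ->; rewrite (negPf vs).
Qed.

Lemma position_setD1 s u v : u \in s ->
  position s v = ((enum_rank u < enum_rank v) + position (s :\ u) v)%N.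
Proof. by move=> us; rewrite -{1}(setD1K us) position_setU1 // setD11. Qed.

(* Left multiplication by v in the exterior algebra. *)
Definition cone v : 'End(chain R X) :=
  extend (fun s => if v \in s then 0 else
                   (-1) ^+ position s v *: elementary_chain R (v |: s)).

Lemma cone_in v s : v \in s -> cone v (elementary_chain R s) = 0.
Proof. by rewrite extendE => ->. Qed.

Lemma cone_notin v s : v \notin s -> cone v (elementary_chain R s) =
  (-1) ^+ position s v *: elementary_chain R (v |: s).
Proof. by rewrite extendE => /negPf->. Qed.

Lemma rank_ltnC u v : u != v ->
  (enum_rank u < enum_rank v)%N = ~~ (enum_rank v < enum_rank u)%N.
Proof.
by rewrite -(inj_eq (@enum_rank_inj X)) -val_eqE /=; case: ltngtP.
Qed.

(** Deleting [v] gives back [c], while deleting another vertex crosses [v] and changes sign. If [v]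
    already lies in the simplex, the left side is zero and on the right only the face opposite [v]
    contributes, cancelling [c]. *)
Lemma boundary_cone v c :
  boundary R X (cone v c) = c - cone v (boundary R X c).
Proof.
suff: (boundary R X \o cone v)%VF =1 (\1 - (cone v \o boundary R X))%VF.
  by move/(_ c); rewrite add_lfunE opp_lfunE !comp_lfunE id_lfunE.
apply: eq_on_elementary => s.
rewrite add_lfunE opp_lfunE !comp_lfunE id_lfunE /=.
rewrite !boundary_elementary /simplex_boundary linear_sum /=.
have [vs|vs] := boolP (v \in s).
  rewrite cone_in // linear0 (bigD1 v) //= big1 => [|u /andP[us uv]].
    rewrite addr0 linearZ /= cone_notin ?setD11 // setD1K // scalerA.
    by rewrite (position_setD1 v vs) ltnn -expr2 sqrr_sign scale1r subrr.
  by rewrite linearZ /= cone_in ?scaler0 // !inE eq_sym uv.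
rewrite cone_notin // linearZ /= boundary_elementary /simplex_boundary.
rewrite big_setU1 //= scalerDr setU1K // position_setU1 // ltnn.
rewrite scalerA -expr2 sqrr_sign scale1r; congr (_ + _).
rewrite scaler_sumr -sumrN; apply: eq_bigr => u us.
have uv : u != v by apply: contraNneq vs => <-.
rewrite [cone v (_ *: _)]linearZ /= cone_notin ?inE ?negb_and ?vs ?orbT //.
rewrite !scalerA -scaleNr.
have -> : (v |: s) :\ u = v |: s :\ u.
  by apply/setP => w; rewrite !inE; case: (w =P v) => // ->; rewrite eq_sym uv.
congr (_ *: _); rewrite position_setU1 // (position_setD1 v us) rank_ltnC //.
(* Exactly one of [u], [v] precedes the other, so exactly one of the two positions shifts by one;
   this is the minus sign. *)
by case: ltnP => _; rewrite !(exprS, expr0, exprD) ?mulN1r ?mulNr ?mul1r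
  ?mulrN ?mulr1 // mulrC.
Qed.

Lemma cone_cone v c : cone v (cone v c) = 0.
Proof.
suff: (cone v \o cone v)%VF =1 (0 : 'End(chain R X)).
  by move/(_ c); rewrite comp_lfunE zero_lfunE.
apply: eq_on_elementary => s; rewrite comp_lfunE zero_lfunE /=.
have [vs|vs] := boolP (v \in s); first by rewrite cone_in ?linear0.
by rewrite cone_notin // linearZ /= cone_in ?scaler0 // setU11.
Qed.

Lemma coneC u v c : cone u (cone v c) = - cone v (cone u c).
Proof.
have [->|uv] := eqVneq u v; first by rewrite cone_cone oppr0.
suff: (cone u \o cone v)%VF =1 (- (cone v \o cone u))%VF.
  by move/(_ c); rewrite opp_lfunE !comp_lfunE.
apply: eq_on_elementary => s; rewrite opp_lfunE !comp_lfunE /=.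
have [us|us] := boolP (u \in s).
  rewrite (cone_in us) linear0 oppr0; have [vs|vs] := boolP (v \in s).
    by rewrite cone_in ?linear0.
  by rewrite cone_notin // linearZ /= cone_in ?scaler0 // setU1r.
have [vs|vs] := boolP (v \in s).
  by rewrite (cone_in vs) linear0 cone_notin // linearZ /= cone_in ?scaler0
     ?oppr0 // setU1r.
rewrite !cone_notin // [cone u (_ *: _)]linearZ [cone v (_ *: _)]linearZ /=.
rewrite !cone_notin ?inE ?negb_or ?uv ?us ?vs //;
  last by rewrite eq_sym uv.
rewrite !scalerA -scaleNr setUCA; congr (_ *: _).
rewrite !position_setU1 // (rank_ltnC uv).
by case: ltnP => _; rewrite !(exprS, expr0, exprD) ?mulN1r ?mulNr ?mul1r
  ?mulrN ?mulr1 ?opprK // mulrC.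
Qed.

(** Arbitrary lists are allowed: a repeated vertex gives zero and a transposition changes the sign,
    so images of simplices under vertex maps need no sorting. *)
Definition wedge l : chain R X := foldr cone (elementary_chain R set0) l.

Definition increasing l :=
  pairwise (fun u v => enum_rank u < enum_rank v)%N l.

Lemma increasing_cons v l : increasing (v :: l) =
  all (fun u => enum_rank v < enum_rank u)%N l && increasing l.
Proof. by []. Qed.

Lemma increasing_enum s : increasing (enum s).
Proof.
have -> : enum s = filter [in s] (enum X).
  by rewrite -filter_predI; apply: eq_filter => x; rewrite !inE /= andbT.
apply: pairwise_filter; case def_e: (enum X) => [//|x0 e]; rewrite -def_e.
apply/(pairwiseP x0) => i j; rewrite !inE => ltiX ltjX ltij.
have rank_nth k : (k < size (enum X))%N ->
    enum_rank (nth x0 (enum X) k) = k :> nat.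
  move=> ltk; apply/eqP; rewrite -(nth_uniq x0 _ ltk (enum_uniq X)).
    by rewrite nth_enum_rank.
  by rewrite -cardT ltn_ord.
by rewrite !rank_nth.
Qed.

Lemma increasing_inj l1 l2 :
  increasing l1 -> increasing l2 -> l1 =i l2 -> l1 = l2.
Proof.
have tr : transitive (fun u v => enum_rank u < enum_rank v)%N.
  by move=> w u v; apply: ltn_trans.
rewrite /increasing -!sorted_pairwise //; apply: irr_sorted_eq => //.
by move=> u; rewrite ltnn.
Qed.

Lemma enum_increasing l : increasing l -> enum [set x in l] = l.
Proof.
move=> inc_l; apply: increasing_inj (increasing_enum _) inc_l _ => x.
by rewrite mem_enum inE.
Qed.

Lemma set_cons v l : [set x in v :: l] = v |: [set x in l].
Proof. by apply/setP => x; rewrite !inE. Qed.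

Lemma wedge_increasing l :
  increasing l -> wedge l = elementary_chain R [set x in l].
Proof.
elim: l => [|v l IHl].
  by move=> _; congr elementary_chain; apply/setP => x; rewrite !inE.
rewrite increasing_cons => /andP[/allP vl inc_l].
rewrite /= IHl // set_cons cone_notin; last first.
  by rewrite inE; apply/negP => /vl; rewrite ltnn.
suff -> : position [set x in l] v = 0%N by rewrite expr0 scale1r.
apply/eqP; rewrite cards_eq0; apply/eqP/setP => u; rewrite !inE.
by apply/negbTE/negP => /andP[/vl/ltnW]; rewrite leqNgt => /negP.
Qed.

Lemma wedge_enum s : wedge (enum s) = elementary_chain R s.
Proof.
rewrite wedge_increasing ?increasing_enum //; congr elementary_chain.
by apply/setP => x; rewrite inE mem_enum.
Qed.

Lemma cone_mem_wedge v l : v \in l -> cone v (wedge l) = 0.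
Proof.
elim: l => //= u l IHl; rewrite inE => /predU1P[->|/IHl vl].
  exact: cone_cone.
by rewrite coneC vl linear0 oppr0.
Qed.

Lemma boundary_wedge_cons v l :
  boundary R X (wedge (v :: l)) = wedge l - cone v (boundary R X (wedge l)).
Proof. exact: boundary_cone. Qed.

Lemma boundary_wedge_nil : boundary R X (wedge [::]) = 0.
Proof. by rewrite /= boundary_elementary /simplex_boundary big_set0. Qed.

(** Carrier and size are recorded together, so that a chain carried by a simplex [U] is a chain of
    the complex in the right degree. *)
Definition subsets_of_card (U : {set X}) k :=
  [set s : {set X} | (s \subset U) && (#|s| == k)].

Lemma cone_spanned (U : {set X}) k v c : v \in U ->
  c \in spanned (subsets_of_card U k) ->
  cone v c \in spanned (subsets_of_card U k.+1).
Proof.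
move=> vU; apply: spanned_image => s; rewrite inE => /andP[sU /eqP cs].
have [vs|vs] := boolP (v \in s); first by rewrite cone_in ?mem0v.
rewrite cone_notin //; apply/memvZ/mem_spanned.
by rewrite inE subUset sub1set vU sU cardsU1 vs cs /=.
Qed.

Lemma wedge_spanned (U : {set X}) l : {subset l <= U} ->
  wedge l \in spanned (subsets_of_card U (size l)).
Proof.
elim: l => [|v l IHl] lU /=.
  by apply: mem_spanned; rewrite inE sub0set cards0.
apply: cone_spanned; first by rewrite lU ?mem_head.
by apply: IHl => x xl; rewrite lU // inE xl orbT.
Qed.

Lemma boundary_powerset (U : {set X}) c :
  c \in spanned (powerset U) -> boundary R X c \in spanned (powerset U).
Proof.
apply: spanned_image => s; rewrite inE => sU.
rewrite boundary_elementary; apply: memv_suml => v vs.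
by apply/memvZ/mem_spanned; rewrite inE (subset_trans (subsetDl _ _) sU).
Qed.

End ExteriorAlgebra.

(** * Chain maps induced by vertex maps, and prism homotopies *)

Section Pushforward.
Variables (R : fieldType) (X Y : finType).
Implicit Types (f g : X -> Y) (s : {set X}) (l : seq X) (c : chain R X).

(** A simplex on which [f] is not injective goes to zero, its image list having a repetition. *)
Definition pushforward f : 'Hom(chain R X, chain R Y) :=
  extend (fun s => wedge R (map f (enum s))).

Lemma pushforward_increasing f l : increasing l ->
  pushforward f (wedge R l) = wedge R (map f l).
Proof.
by move=> inc_l; rewrite wedge_increasing // extendE enum_increasing.
Qed.

(** Moving [v] into place takes transpositions, whose parity is [b]; anticommutation gives the same
    sign after applying [f], whether or not [f] respects the order. This makes [pushforward], known
    on increasing lists, commute with [cone]. *)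
Lemma insert_increasing f v l : increasing l -> v \notin l ->
  exists (l' : seq X) (b : bool), [/\ increasing l', l' =i v :: l,
    cone R v (wedge R l) = (-1) ^+ b *: wedge R l' &
    cone R (f v) (wedge R (map f l)) = (-1) ^+ b *: wedge R (map f l')].
Proof.
elim: l => [|u l IHl].
  by move=> _ _; exists [:: v], false; rewrite !expr0 !scale1r.
rewrite increasing_cons inE negb_or => /andP[/allP ul inc_l].
case/andP=> vu vl; have [ltvu|ltuv] := boolP (enum_rank v < enum_rank u)%N.
  exists [:: v, u & l], false; rewrite !expr0 !scale1r; split=> //.
  rewrite !increasing_cons inc_l andbT /= ltvu /=.
  apply/andP; split; apply/allP => x /ul //; exact: ltn_trans.
have [l' [b [inc_l' l'E vE fE]]] := IHl inc_l vl.
exists (u :: l'), (~~ b); rewrite signrN !scaleNr /=; split.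
- rewrite inc_l' andbT.
  apply/allP => x; rewrite l'E inE => /predU1P[->|/ul //].
  by rewrite rank_ltnC // eq_sym.
- by move=> x; rewrite !inE l'E inE orbCA.
- by rewrite coneC vE linearZ.
by rewrite coneC fE linearZ.
Qed.

Lemma pushforward_cone f v c :
  pushforward f (cone R v c) = cone R (f v) (pushforward f c).
Proof.
suff: (pushforward f \o cone R v)%VF =1 (cone R (f v) \o pushforward f)%VF.
  by move/(_ c); rewrite !comp_lfunE.
apply: eq_on_elementary => s; rewrite !comp_lfunE /= -(wedge_enum R s).
have inc_s := increasing_enum s; rewrite (pushforward_increasing f inc_s).
have [vs|vs] := boolP (v \in enum s).
  by rewrite !cone_mem_wedge ?linear0 // map_f.
have [l' [b [inc_l' _ -> ->]]] := insert_increasing f inc_s vs.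
by rewrite linearZ /= pushforward_increasing.
Qed.

Lemma pushforward_wedge f l : pushforward f (wedge R l) = wedge R (map f l).
Proof.
elim: l => [|v l IHl]; first exact: pushforward_increasing.
by rewrite /= pushforward_cone IHl.
Qed.

Lemma boundary_pushforward f c :
  boundary R Y (pushforward f c) = pushforward f (boundary R X c).
Proof.
suff: (boundary R Y \o pushforward f)%VF =1 (pushforward f \o boundary R X)%VF.
  by move/(_ c); rewrite !comp_lfunE.
apply: eq_on_elementary => s; rewrite !comp_lfunE /= -(wedge_enum R s).
elim: (enum s) => [|v l IHl].
  by rewrite pushforward_wedge !boundary_wedge_nil linear0.
rewrite pushforward_wedge in IHl; rewrite pushforward_wedge map_cons.
rewrite !boundary_wedge_cons [pushforward f _]linearB IHl /=.
by rewrite pushforward_cone pushforward_wedge.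
Qed.

Lemma pushforward_spanned f s :
  pushforward f (elementary_chain R s) \in
  spanned R (subsets_of_card (f @: s) #|s|).
Proof.
rewrite -(wedge_enum R s) pushforward_wedge cardE -(size_map f).
apply: wedge_spanned => _ /mapP[x xs ->]; apply: imset_f.
by rewrite mem_enum in xs.
Qed.

(* The prism operator: [prism f g [v0; ...; vk]] is the alternating sum of
   the (f v0, ..., f vi, g vi, ..., g vk). *)
Fixpoint prism f g l : chain R Y :=
  if l is v :: l' then
    cone R (f v) (cone R (g v) (wedge R (map g l'))) -
    cone R (f v) (prism f g l')
  else 0.

Definition homotopy f g : 'Hom(chain R X, chain R Y) :=
  extend (fun s => prism f g (enum s)).

Lemma homotopy_increasing f g l : increasing l ->
  homotopy f g (wedge R l) = prism f g l.
Proof.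
by move=> inc_l; rewrite wedge_increasing // extendE enum_increasing.
Qed.

(** The recursion of [prism], carried from lists to chains on vertices after [v]: the prism identity
    needs it for the boundary of [wedge l], which is not a single simplex. *)
Lemma homotopy_cone f g v l c : increasing (v :: l) ->
  c \in spanned R (powerset [set x in l]) ->
  homotopy f g (cone R v c) =
    cone R (f v) (cone R (g v) (pushforward g c)) -
    cone R (f v) (homotopy f g c).
Proof.
move=> inc_vl cl; apply/eqP; rewrite -subr_eq0 -memv0.
pose d : 'Hom(chain R X, chain R Y) :=
  ((homotopy f g \o cone R v) -
    ((cone R (f v) \o (cone R (g v) \o pushforward g)) -
     (cone R (f v) \o homotopy f g)))%VF.
have -> : homotopy f g (cone R v c) -
    (cone R (f v) (cone R (g v) (pushforward g c)) -
    cone R (f v) (homotopy f g c)) = d c.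
  by rewrite /d !(add_lfunE, opp_lfunE, comp_lfunE).
apply: spanned_image cl => s; rewrite inE => /subsetP sl.
rewrite memv0 /d !(add_lfunE, opp_lfunE, comp_lfunE) /= subr_eq0; apply/eqP.
have inc_vs : increasing (v :: enum s).
  move: inc_vl; rewrite !increasing_cons => /andP[/allP vl _].
  rewrite increasing_enum andbT; apply/allP => x.
  by rewrite mem_enum => /sl; rewrite inE => /vl.
rewrite -(wedge_enum R s) pushforward_wedge -[cone R v _]/(wedge R (v :: _)).
by rewrite !homotopy_increasing // increasing_enum.
Qed.

Lemma homotopyP f g c :
  boundary R Y (homotopy f g c) + homotopy f g (boundary R X c) =
  pushforward g c - pushforward f c.
Proof.
suff: ((boundary R Y \o homotopy f g) + (homotopy f g \o boundary R X))%VF =1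
  (pushforward g - pushforward f)%VF.
  by move/(_ c); rewrite !(add_lfunE, opp_lfunE, comp_lfunE).
apply: eq_on_elementary => s; rewrite !(add_lfunE, opp_lfunE, comp_lfunE) /=.
rewrite -(wedge_enum R s).
elim: (enum s) (increasing_enum s) => [|v l IHl] inc_vl.
  rewrite boundary_wedge_nil linear0 homotopy_increasing // linear0 addr0.
  by rewrite !pushforward_wedge subrr.
have inc_l : increasing l.
  by move: inc_vl; rewrite increasing_cons => /andP[].
have dl : boundary R X (wedge R l) \in spanned R (powerset [set x in l]).
  apply: boundary_powerset; rewrite wedge_increasing //.
  by apply: mem_spanned; rewrite inE.
have IH := IHl inc_l; rewrite homotopy_increasing // boundary_wedge_cons.
rewrite [homotopy f g (_ - _)]linearB /= (homotopy_cone f g inc_vl dl).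
rewrite (homotopy_increasing f g inc_l) in IH *.
rewrite -boundary_pushforward !pushforward_cone !pushforward_wedge in IH *.
set G := wedge R (map g l) in IH *; set F := wedge R (map f l) in IH *.
set P := prism f g l in IH *; set Q := homotopy f g _ in IH *.
(* The induction hypothesis eliminates the boundary of [P]; after the antiderivation rule everything
   cancels except [cone (g v) G] and [cone (f v) F]. *)
have dP : cone R (f v) (boundary R Y P) =
    cone R (f v) G - cone R (f v) F - cone R (f v) Q.
  have -> : boundary R Y P = G - F - Q by rewrite -IH addrK.
  by rewrite !(linearB (cone R (f v))).
rewrite [boundary _ _ (_ - _)]linearB /= !boundary_cone dP.
rewrite [cone R (f v) (_ - _)]linearB /= !opprB !addrA !subrK.
by rewrite (addrAC _ (- cone R (f v) F)) addrK.
Qed.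

Lemma homotopy_spanned f g s :
  homotopy f g (elementary_chain R s) \in
  spanned R (subsets_of_card (f @: s :|: g @: s) #|s|.+1).
Proof.
rewrite extendE cardE; set U := f @: s :|: g @: s.
have : {subset enum s <= s} by move=> x; rewrite mem_enum.
elim: (enum s) => [|v l IHl] sub_l; first exact: mem0v.
have vs : v \in s by rewrite sub_l ?mem_head.
have sub_l' : {subset l <= s} by move=> x xl; rewrite sub_l // inE xl orbT.
have fvU : f v \in U by rewrite inE imset_f.
have gvU : g v \in U by rewrite inE imset_f ?orbT.
rewrite /= memvB // ?(cone_spanned fvU) ?IHl // (cone_spanned gvU) //.
rewrite -(size_map g); apply: wedge_spanned => _ /mapP[x xl ->].
by rewrite inE imset_f ?orbT // sub_l'.
Qed.

End Pushforward.

Lemma pushforward_comp (R : fieldType) (X Y Z : finType) (f : X -> Y)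
    (g : Y -> Z) (c : chain R X) :
  pushforward R (g \o f) c = pushforward R g (pushforward R f c).
Proof.
suff: pushforward R (g \o f) =1 (pushforward R g \o pushforward R f)%VF.
  by move/(_ c); rewrite comp_lfunE.
apply: eq_on_elementary => s; rewrite comp_lfunE -(wedge_enum R s).
by rewrite !pushforward_wedge map_comp.
Qed.

Lemma pushforward_id (R : fieldType) (X : finType) (f : X -> X)
    (c : chain R X) : f =1 id -> pushforward R f c = c.
Proof.
move=> f_id; suff: pushforward R f =1 (\1)%VF.
  by move/(_ c); rewrite id_lfunE.
apply: eq_on_elementary => s; rewrite id_lfunE -(wedge_enum R s).
by rewrite pushforward_wedge map_id_in // => x _; apply: f_id.
Qed.

(** * Simplicial and contiguous maps on homology *)

Section SimplicialMaps.
Variables (R : fieldType) (X Y : finType).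
Variables (K : simplicial_complex X) (L : simplicial_complex Y).
Implicit Types (f g : X -> Y) (c : chain R X).

Definition simplicial f := forall s, s \in K -> f @: s \in L.

Definition contiguous f g := forall s, s \in K -> f @: s :|: g @: s \in L.

Lemma spanned_chains (U : {set Y}) k (d : chain R Y) :
  U \in set0 |: simplices L ->
  d \in spanned R (subsets_of_card U k) -> d \in chains R L k.
Proof.
move=> UL; apply: subvP; apply: sub_span => _ /mapP[t tU ->]; apply: map_f.
move: tU; rewrite !mem_enum !inE => /andP[tU ->]; rewrite andbT.
have [//|t0] := eqVneq t set0; move: UL; rewrite !inE.
case/predU1P => [U0|UL]; first by rewrite U0 subset0 (negPf t0) in tU.
exact: simplices_closed UL tU t0.
Qed.

Lemma linear_chains (F : 'Hom(chain R X, chain R Y)) k m c :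
  (forall s, s \in set0 |: simplices K -> #|s| = k ->
     F (elementary_chain R s) \in chains R L m) ->
  c \in chains R K k -> F c \in chains R L m.
Proof.
move=> FL; apply: spanned_image => s; rewrite inE => /andP[sK /eqP].
exact: FL.
Qed.

Lemma pushforward_chains f k c : simplicial f ->
  c \in chains R K k -> pushforward R f c \in chains R L k.
Proof.
move=> fKL; apply: linear_chains => s sK <-.
apply: spanned_chains (pushforward_spanned R f s).
move: sK; rewrite !inE => /predU1P[->|/fKL->]; last by rewrite orbT.
by rewrite imset0 eqxx.
Qed.

Lemma homotopy_chains f g k c : contiguous f g ->
  c \in chains R K k -> homotopy R f g c \in chains R L k.+1.
Proof.
move=> fgKL; apply: linear_chains => s sK <-.
apply: spanned_chains (homotopy_spanned R f g s).
move: sK; rewrite !inE => /predU1P[->|/fgKL->]; last by rewrite orbT.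
by rewrite !imset0 setU0 eqxx.
Qed.

Lemma pushforward_cycles f q c : simplicial f ->
  c \in cycles R K q -> pushforward R f c \in cycles R L q.
Proof.
move=> fKL; rewrite !memv_cap !memv_ker => /andP[cK /eqP dc].
by rewrite pushforward_chains // boundary_pushforward dc linear0 eqxx.
Qed.

Lemma pushforward_boundaries f q c : simplicial f ->
  c \in boundaries R K q -> pushforward R f c \in boundaries R L q.
Proof.
move=> fKL /memv_imgP[b bK ->]; rewrite -boundary_pushforward memv_img //.
exact: pushforward_chains.
Qed.

(** On a cycle the prism identity leaves only a boundary. *)
Lemma contiguous_homologous f g q c : contiguous f g ->
  c \in cycles R K q ->
  pushforward R g c - pushforward R f c \in boundaries R L q.
Proof.
move=> fgKL; rewrite memv_cap memv_ker => /andP[cK /eqP dc].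
by rewrite -homotopyP dc linear0 addr0 memv_img // homotopy_chains.
Qed.

End SimplicialMaps.

(** * Ranks of homology and independent retracts *)

Lemma rank_homologyE (R : fieldType) (X : finType)
    (K : simplicial_complex X) q :
  (rank_reduced_homology R K q + \dim (boundaries R K q) =
   \dim (cycles R K q))%N.
Proof.
rewrite -(dimv_cap_compl (cycles R K q) (boundaries R K q)) addnC.
by rewrite (capv_idPr (boundaries_sub_cycles R K q)).
Qed.

Lemma homology_trivialP (R : fieldType) (X : finType)
    (K : simplicial_complex X) q :
  reflect (reduced_homology R K q = 0%VS)
    (cycles R K q <= boundaries R K q)%VS.
Proof. by rewrite -diffv_eq0; apply: eqP. Qed.

Lemma eq_pushforward (R : fieldType) (X Y : finType) (f g : X -> Y)
    (c : chain R X) : f =1 g -> pushforward R f c = pushforward R g c.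
Proof.
move=> fg; suff: pushforward R f =1 pushforward R g by [].
apply: eq_on_elementary => s; rewrite -(wedge_enum R s) !pushforward_wedge.
by rewrite (eq_map fg).
Qed.

(** The copies are independent modulo boundaries: [ret a] restores the copy of index [a] and turns
    the other copies into boundaries. *)
Lemma rank_homology_retracts (R : fieldType) (I X Y : finType)
    (K : simplicial_complex X) (L : simplicial_complex Y) (q : nat)
    (inc : I -> X -> Y) (ret : I -> Y -> X) :
  (forall a, simplicial K L (inc a)) ->
  (forall a, simplicial L K (ret a)) ->
  (forall a x, ret a (inc a x) = x) ->
  (forall a b c, a != b -> c \in cycles R K q ->
     pushforward R (ret a \o inc b) c \in boundaries R K q) ->
  (#|I| * rank_reduced_homology R K q <= rank_reduced_homology R L q)%N.
Proof.
move=> simp_inc simp_ret retK ret_inc.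
pose H := reduced_homology R K q; pose B := boundaries R L q.
(* Including [B] in the sum replaces independence in the quotient by a dimension count among
   chains. *)
pose U s := (\sum_(a <- s) (pushforward R (inc a) @: H) + B)%VS.
have HZ : (H <= cycles R K q)%VS := diffvSl _ _.
have dimU s : uniq s -> \dim (U s) = (size s * \dim H + \dim B)%N.
  elim: s => [_|a s IHs /= /andP[as_ uniq_s]].
    by rewrite /U big_nil add0v.
  (* Since [a] is not in [s], the retraction [ret a] sends all of [U s] into boundaries. *)
  have US : (U s <= pushforward R (ret a) @^-1: boundaries R K q)%VS.
    rewrite subv_add; apply/andP; split; last first.
      apply/subvP => b bB; rewrite -memv_preim.
      by apply: pushforward_boundaries bB.
    rewrite big_seq; elim/big_ind: _ => [|V W VU WU|b bs]; rewrite ?sub0v //.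
      by rewrite subv_add VU.
    apply/subvP => _ /memv_imgP[c cH ->].
    rewrite -memv_preim -pushforward_comp ret_inc ?(subvP HZ) //.
    by apply: contraNneq as_ => ->.
  have incK c : pushforward R (ret a) (pushforward R (inc a) c) = c.
    by rewrite -pushforward_comp pushforward_id //; apply: retK.
  have -> : U (a :: s) = (pushforward R (inc a) @: H + U s)%VS.
    by rewrite /U big_cons addvA.
  rewrite dimv_disjoint_sum ?IHs // ?(@limg_dim_eq _ _ _ _ H) ?mulSn ?addnA //.
    apply/eqP; rewrite -subv0; apply/subvP => c; rewrite memv_cap memv_ker.
    by case/andP=> _ /eqP c0; rewrite -(incK c) c0 linear0 mem0v.
  (* For a common vector, applying [ret a] shows that [c] is a boundary; but [H] is a complement of
     the boundaries, so [c] vanishes. *)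
  apply/eqP; rewrite -subv0; apply/subvP => d; rewrite memv_cap.
  case/andP=> /memv_imgP[c cH ->] /(subvP US); rewrite -memv_preim incK => cB.
  have : c \in (H :&: boundaries R K q)%VS by rewrite memv_cap cH.
  by rewrite capv_diff [c \in _]memv0 => /eqP->; rewrite linear0 mem0v.
rewrite -(leq_add2r (\dim B)) rank_homologyE cardE -dimU ?enum_uniq //.
apply: dimvS; rewrite subv_add boundaries_sub_cycles andbT.
elim/big_ind: _ => [|V W VU WU|a _]; rewrite ?sub0v ?subv_add ?VU //.
apply/subvP => _ /memv_imgP[c cH ->].
by apply: pushforward_cycles (simp_inc a) _; apply: subvP cH.
Qed.

(** * Simplices as pairwise intersecting families *)

Lemma VRF_simplexE n m (s : {set Fsets n m}) : (0 < n)%N ->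
  (s \in simplices (VRF n m (2 * (n - 1)))) =
  (s != set0) && [forall A in s, forall B in s, val A :&: val B != set0].
Proof.
move=> n_gt0; rewrite inE; congr (_ && _).
apply: eq_forallb => A; congr (_ ==> _); apply: eq_forallb => B.
congr (_ ==> _); rewrite /Fdist cardsU.
have -> : (val A :\: val B) :&: (val B :\: val A) = set0.
  by apply/setP => x; rewrite !inE; case: (x \in val A); rewrite /= ?andbF.
rewrite cards0 subn0 !cardsD (eqP (valP A)) (eqP (valP B)) setIC.
have : (#|val B :&: val A| <= n)%N.
  by rewrite -[leqRHS](eqP (valP B)) subset_leq_card // subsetIl.
(* The distance is twice [n] minus the size of the intersection. Disjoint sets are at distance
   [2 * n], which exceeds the bound because [n] is positive. *)
rewrite -card_gt0; case: #|_| => [|k] lekn; last first.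
  by rewrite addnn -mul2n leq_mul2l leq_sub2l.
by rewrite subn0 addnn -mul2n leq_mul2l /= leqNgt subn1 prednK ?leqnn.
Qed.

Section SetMaps.
Variables n m m' : nat.
Hypothesis n_gt0 : (0 < n)%N.
Implicit Types f g : Fsets n m -> Fsets n m'.

Lemma VRF_contiguous f g :
  (forall A B : Fsets n m, val A :&: val B != set0 ->
     [&& val (f A) :&: val (f B) != set0, val (g A) :&: val (g B) != set0
       & val (f A) :&: val (g B) != set0]) ->
  contiguous (VRF n m (2 * (n - 1))) (VRF n m' (2 * (n - 1))) f g.
Proof.
move=> fgI s; rewrite !VRF_simplexE // => /andP[s0 sI].
have {}fgI A B (As : A \in s) (Bs : B \in s) :=
  fgI A B (forall_inP (forall_inP sI A As) B Bs).
apply/andP; split.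
  case/set0Pn: s0 => A As; apply/set0Pn; exists (f A).
  by rewrite inE imset_f.
apply/forall_inP => _ /setUP[] /imsetP[A As ->];
  apply/forall_inP => _ /setUP[] /imsetP[B Bs ->].
- by have /and3P[] := fgI A B As Bs.
- by have /and3P[] := fgI A B As Bs.
(* The other mixed pair is the same condition with [A] and [B] exchanged. *)
- by rewrite setIC; have /and3P[] := fgI B A Bs As.
- by have /and3P[] := fgI A B As Bs.
Qed.

Lemma VRF_simplicial f :
  (forall A B : Fsets n m, val A :&: val B != set0 ->
     val (f A) :&: val (f B) != set0) ->
  simplicial (VRF n m (2 * (n - 1))) (VRF n m' (2 * (n - 1))) f.
Proof.
move=> fI s; rewrite -[f @: s]setUid; apply: VRF_contiguous => A B /fI ->.
by [].
Qed.

Lemma fsets_map_subproof (phi : {set 'I_m} -> {set 'I_m'})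
    (card_phi : forall A : {set 'I_m}, #|A| = n -> #|phi A| = n)
    (A : Fsets n m) :
  #|phi (val A)| == n.
Proof. by rewrite card_phi //; apply/eqP/(valP A). Qed.

Definition fsets_map (phi : {set 'I_m} -> {set 'I_m'})
    (card_phi : forall A : {set 'I_m}, #|A| = n -> #|phi A| = n)
    (A : Fsets n m) :
  Fsets n m' := exist _ (phi (val A)) (fsets_map_subproof card_phi A).

End SetMaps.

(** * Trading one point of a set for another *)

Section Retractions.
Variable m : nat.
Implicit Types (i j : 'I_m.+1) (k x : 'I_m) (J B : {set 'I_m}).
Implicit Type A : {set 'I_m.+1}.

Definition embed i B : {set 'I_m.+1} := lift i @: B.

Definition restrict i A : {set 'I_m} := lift i @^-1: A.

(** Preferring [k] ensures that it is present after every trade. The default of [odflt] is a dummy,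
    reached only when [B] and [J] cover the ground set. *)
Definition replacement k J B : 'I_m :=
  if k \notin B then k else odflt k [pick x | x \notin B :|: J].

(* The retraction onto the sets avoiding i trades i for k, or for another
   element outside J if k is already present. *)
Definition retract i k J A : {set 'I_m} :=
  if i \in A then replacement k J (restrict i A) |: restrict i A
  else restrict i A.

Lemma card_embed i B : #|embed i B| = #|B|.
Proof. exact/card_imset/lift_inj. Qed.

Lemma notin_embed i B : i \notin embed i B.
Proof. by apply/imsetP => -[x _ /eqP]; rewrite (negPf (neq_lift i x)). Qed.

Lemma embedK i B : restrict i (embed i B) = B.
Proof. by apply/setP => x; rewrite inE mem_imset //; apply: lift_inj. Qed.

Lemma restrictK i A : embed i (restrict i A) = A :\ i.
Proof.
apply/setP => y; rewrite !inE; case: (unliftP i y) => [x|] ->.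
  by rewrite mem_imset ?inE 1?eq_sym ?neq_lift //; apply: lift_inj.
by rewrite eqxx (negPf (notin_embed _ _)).
Qed.

Lemma restrictK_notin i A : i \notin A -> embed i (restrict i A) = A.
Proof.
move=> iA; rewrite restrictK; apply/setDidPl.
by rewrite disjoint_sym disjoints1.
Qed.

Lemma card_restrict i A : #|restrict i A| = #|A :\ i|.
Proof. by rewrite -restrictK card_embed. Qed.

Lemma mem_retract i k J A : i \in A -> k \in retract i k J A.
Proof.
move=> iA; rewrite /retract iA /replacement.
by have [kA|kA] := boolP (k \in restrict i A); rewrite in_setU1 ?kA ?orbT ?eqxx.
Qed.

Lemma restrict_sub i k J A : restrict i A \subset retract i k J A.
Proof. by rewrite /retract; case: ifP => // _; apply: subsetUr. Qed.

Lemma card_retract i k J A : (#|A| + #|J| <= m)%N -> #|retract i k J A| = #|A|.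
Proof.
move=> leAm; rewrite /retract (cardsD1 i A) -card_restrict.
case: ifP => iA //; rewrite cardsU1 (_ : _ \notin _) //.
rewrite /replacement; have [kA|//] := boolP (k \in restrict i A).
case: pickP => [x|full]; first by rewrite inE negb_or => /andP[].
(* Dropping [i] from [A] makes the bound strict, which leaves a free point. *)
have: (#|restrict i A :|: J| < m)%N.
  apply: leq_ltn_trans (leq_card_setU _ _) _; apply: leq_trans leAm.
  by rewrite card_restrict (cardsD1 i A) iA.
rewrite -[X in (_ < X)%N]card_ord -cardsT.
suff -> : restrict i A :|: J = setT by rewrite ltnn.
by apply/setP => x; rewrite in_setT; apply/negbFE/full.
Qed.

Lemma retract_embed i k J B : retract i k J (embed i B) = B.
Proof. by rewrite /retract (negPf (notin_embed _ _)) embedK. Qed.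

(** A common point other than [i] survives; if [i] is common, both images contain [k]. Allowing
    different [J] and [J'] is what yields contiguity. *)
Lemma retract_meet i k J J' A A' : A :&: A' != set0 ->
  retract i k J A :&: retract i k J' A' != set0.
Proof.
case/set0Pn => y /setIP[yA yA']; apply/set0Pn.
case: (unliftP i y) yA yA' => [x|] -> xA xA'; last first.
  by exists k; rewrite inE !mem_retract.
by exists x; rewrite inE !(subsetP (restrict_sub _ _ _ _)) // inE.
Qed.

Lemma embed_meet i B B' : B :&: B' != set0 -> embed i B :&: embed i B' != set0.
Proof.
case/set0Pn => x /setIP[xB xB']; apply/set0Pn; exists (lift i x).
by rewrite inE !imset_f.
Qed.

Lemma restrict_meet i A A' : i \notin A -> A :&: A' != set0 ->
  restrict i A :&: restrict i A' != set0.
Proof.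
move=> iA /set0Pn[y /setIP[]]; case: (unliftP i y) => [x|] -> xA xA'.
  by apply/set0Pn; exists x; rewrite !inE xA.
by rewrite xA in iA.
Qed.

(** Here [x] is the label of [j] once [i] is removed; a trade brings in [k] or a point outside the
    singleton of [x]. *)
Lemma notin_retract_embed i j k x B : lift i x = j -> k != x ->
  x \notin retract i k [set x] (embed j B).
Proof.
move=> ixj kx; have xR : x \notin restrict i (embed j B).
  by rewrite inE ixj notin_embed.
rewrite /retract; case: ifP => // _; rewrite inE negb_or xR andbT inE.
rewrite /replacement; case: ifP => _; first by rewrite eq_sym.
case: pickP => [y|_] /=; last by rewrite eq_sym.
by rewrite !inE negb_or eq_sym => /andP[].
Qed.

End Retractions.

(** * Inclusions and retractions between the complexes *)

Section KneserMaps.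
Variables n m : nat.
Hypothesis n_gt0 : (0 < n)%N.
Notation VRn p := (VRF n p (2 * (n - 1))).

Lemma card_embed_eq (i : 'I_m.+1) (B : {set 'I_m}) :
  #|B| = n -> #|embed i B| = n.
Proof. by rewrite card_embed. Qed.

Definition fembed i : Fsets n m -> Fsets n m.+1 :=
  fsets_map (card_embed_eq i).

Lemma fembed_simplicial i : simplicial (VRn m) (VRn m.+1) (fembed i).
Proof. by apply: VRF_simplicial => // A B; apply: embed_meet. Qed.

Section Retract.
Variables (i : 'I_m.+1) (k : 'I_m) (J : {set 'I_m}).
Hypothesis J_small : (n + #|J| <= m)%N.

Lemma card_retract_eq (A : {set 'I_m.+1}) : #|A| = n -> #|retract i k J A| = n.
Proof. by move=> cA; rewrite card_retract cA. Qed.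

Definition fretract : Fsets n m.+1 -> Fsets n m := fsets_map card_retract_eq.

Lemma fretract_simplicial : simplicial (VRn m.+1) (VRn m) fretract.
Proof. by apply: VRF_simplicial => // A B; apply: retract_meet. Qed.

Lemma fretract_embed A : fretract (fembed i A) = A.
Proof. exact/val_inj/retract_embed. Qed.

End Retract.

End KneserMaps.

(** * Vanishing of mixed composites and the rank inequality *)

Section Homology.
Variables (R : fieldType) (n q : nat).
Hypothesis n_gt0 : (0 < n)%N.
Notation VRn p := (VRF n p (2 * (n - 1))).

(* Up to contiguity the retraction may be chosen to avoid j, so that the
   composite factors through the complex with i and j both removed. *)
Lemma fretract_embed_homologous m (i j : 'I_m.+2) (k : 'I_m.+1)
    (J : {set 'I_m.+1}) (J_small : (n + #|J| <= m.+1)%N)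
    (c : chain R (Fsets n m.+1)) :
  (n <= m)%N -> i != j -> lift i k != j ->
  reduced_homology R (VRn m) q = 0%VS -> c \in cycles R (VRn m.+1) q ->
  pushforward R (fretract i k J_small \o fembed j) c
    \in boundaries R (VRn m.+1) q.
Proof.
move=> le_n_m ij ikj /homology_trivialP triv cZ.
have [x ixj kx] : exists2 x, lift i x = j & k != x.
  case: (unliftP i j) ij ikj => [x -> _|-> /eqP//].
  by rewrite (inj_eq lift_inj) => kx; exists x.
(* The bound [n <= m] leaves room to forbid the single point [x]. *)
have x_small : (n + #|[set x]| <= m.+1)%N by rewrite cards1 addn1.
pose f : Fsets n m.+1 -> Fsets n m.+1 := fretract i k x_small \o fembed j.
have xf A : x \notin val (f A) by apply: notin_retract_embed.
pose phi (B : {set 'I_m.+1}) := retract i k [set x] (embed j B).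
have card_g (B : {set 'I_m.+1}) : #|B| = n -> #|restrict x (phi B)| = n.
  move=> cB; rewrite -(card_embed x) restrictK_notin ?notin_retract_embed //.
  by apply: (card_retract_eq i k x_small); apply: card_embed_eq.
pose g : Fsets n m.+1 -> Fsets n m := fsets_map card_g.
have fE : f =1 fembed x \o g.
  by move=> A; apply: val_inj; rewrite /= restrictK_notin //; apply: xf.
have simp_g : simplicial (VRn m.+1) (VRn m) g.
  apply: VRF_simplicial => // A B AB; apply: restrict_meet (xf A) _.
  exact/retract_meet/embed_meet.
have fB : pushforward R f c \in boundaries R (VRn m.+1) q.
  rewrite (eq_pushforward _ fE) pushforward_comp.
  apply: pushforward_boundaries (fembed_simplicial n_gt0 x) _.
  exact/(subvP triv)/(pushforward_cycles simp_g).
(* It remains to change the forbidden set from [J] to the singleton of [x], which contiguity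
   permits. *)
rewrite -(subrK (pushforward R f c) (pushforward _ _ _)) memvD //.
apply: contiguous_homologous cZ; apply: VRF_contiguous => // A B AB.
by rewrite !retract_meet ?embed_meet.
Qed.

(** The only vertex is the whole ground set, whereas a [q]-simplex with [q] positive has at least
    two vertices. *)
Lemma homology_point : (0 < q)%N -> reduced_homology R (VRn n) q = 0%VS.
Proof.
move=> q_gt0; apply/homology_trivialP/(subv_trans (capvSl _ _)).
apply/span_subvP => c /mapP[s]; rewrite mem_enum inE => /andP[_ /eqP cs] _.
have /card_gt1P[A [B [_ _ /eqP[]]]] : (1 < #|s|)%N by rewrite cs.
suff fullT (C : Fsets n n) : val C = setT by apply: val_inj; rewrite !fullT.
by apply/eqP; rewrite eqEcard subsetT cardsT card_ord (eqP (valP C)) leqnn.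
Qed.

Lemma rank_homology_step m : (n <= m)%N ->
  reduced_homology R (VRn m) q = 0%VS ->
  (m.+1 * rank_reduced_homology R (VRn m.+1) q <=
   rank_reduced_homology R (VRn m.+2) q)%N.
Proof.
move=> le_n_m triv.
have J_small : (n + #|@set0 'I_m.+1| <= m.+1)%N by rewrite cards0 addn0 leqW.
rewrite -[X in (X * _)%N]card_ord.
(* The fixed point is [ord0], and [lift ord0 a] runs over the other points. With such a point
   removed, the fixed one is still labelled [ord0]. *)
pose inc (a : 'I_m.+1) := @fembed n m.+1 (lift ord0 a).
pose ret (a : 'I_m.+1) := fretract (lift ord0 a) ord0 J_small.
apply: (@rank_homology_retracts _ _ _ _ _ _ _ inc ret) => [a|a|a A|a b c ab cZ].
- exact: fembed_simplicial.
- exact: fretract_simplicial.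
- exact: fretract_embed.
by apply: fretract_embed_homologous.
Qed.

End Homology.

Theorem theorem5p1 (R : realType) (n q ell : nat)
  (n_ge1 : (1 <= n)%N) (q_ge1 : (1 <= q)%N) (n_le_ell : (n <= ell)%N)
  (ell_nontrivial :
    reduced_homology R (VRF n ell (2 * (n - 1))) q <> 0%VS)
  (ell_smallest : forall m : nat, (n <= m)%N ->
    reduced_homology R (VRF n m (2 * (n - 1))) q <> 0%VS -> (ell <= m)%N) :
  (ell * rank_reduced_homology R (VRF n ell (2 * (n - 1))) q <=
   rank_reduced_homology R (VRF n ell.+1 (2 * (n - 1))) q)%N.
Proof.
(* Strictness makes the predecessor of [ell] at least [n], so that minimality applies to it. *)
have lt_n_ell : (n < ell)%N.
  rewrite ltn_neqAle n_le_ell andbT; apply/eqP => n_ell.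
  by apply: ell_nontrivial; rewrite -n_ell homology_point.
case: ell => [|m] // in n_le_ell ell_nontrivial ell_smallest lt_n_ell *.
apply: rank_homology_step => //; apply/eqP/negPn/negP => /eqP nontriv.
by have := ell_smallest m lt_n_ell nontriv; rewrite ltnn.
Qed.
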